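(* Fix an integer $n>1$. For each $1\le k\le n-1$ let $a_k\in\ell_0^1(\mathbb{Z}/n\mathbb{Z})$ be the unique element such that $X[a_k]=e_k$, where $\{e_k\}_{k=1}^{n-1}$ is the standard basis of $\mathbb{C}^{n-1}$. Then: (1) each $a_k$ is an idempotent of norm at least one; (2) $a_ka_j=0$ for all $k\ne j$; (3) $a_1+a_2+\cdots+a_{n-1}=\mathbf{1}_0$; (4) $\{a_k\}_{k=1}^{n-1}$ forms a basis for $\ell_0^1(\mathbb{Z}/n\mathbb{Z})$; (5) each non-zero idempotent of $\ell_0^1(\mathbb{Z}/n\mathbb{Z})$ is of the form $\varepsilon_1a_1+\varepsilon_2a_2+\cdots+\varepsilon_{n-1}a_{n-1}$ for some $(\varepsilon_1,\ldots,\varepsilon_{n-1})\in\{0,1\}^{n-1}\setminus\{(0,\ldots,0)\}$; (6) $\ell_0^1(\mathbb{Z}/n\mathbb{Z})$ has precisely $2^{n-1}$ idempotents.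
   Context: $\ell^1(\mathbb{Z}/n\mathbb{Z})$ is the algebra of functions $a\colon\mathbb{Z}/n\mathbb{Z}\to\mathbb{C}$ with convolution product and norm $\|a\|_1=\sum_g|a(g)|$; write $\mathbb{Z}/n\mathbb{Z}=\{[0],[1],\ldots,[n-1]\}$. $\ell_0^1(\mathbb{Z}/n\mathbb{Z})=\{a\in\ell^1(\mathbb{Z}/n\mathbb{Z}):\sum_g a(g)=0\}$, with norm $\|\cdot\|_1$. With $\delta_g$ the indicator function of $\{g\}$ and $\Delta_g=\delta_g-\delta_{[0]}$, the algebra $\ell_0^1(\mathbb{Z}/n\mathbb{Z})$ has multiplicative identity $\mathbf{1}_0=-\frac1n\sum_{g}\Delta_g$. Each $a\in\ell_0^1(\mathbb{Z}/n\mathbb{Z})$ is uniquely determined by the column vector $[a]=(a([1]),\ldots,a([n-1]))\in\mathbb{C}^{n-1}$. The translation matrix is the $(n-1)\times(n-1)$ matrix $X=(x_{j,[k]})_{1\le j,k\le n-1}$ with $x_{j,[k]}=\exp(2\pi i jk/n)-1$. For every $v\in\mathbb{C}^{n-1}$ there is a unique $a\in\ell_0^1(\mathbb{Z}/n\mathbb{Z})$ with $X[a]=v$. *)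

(* Defs.v *)
From HB Require Import structures.
From mathcomp Require Import all_boot all_order all_algebra.
From mathcomp Require Import all_classical all_reals all_analysis.
From mathcomp Require Import complex.
From mathcomp Require Import ring lra.

Set Implicit Arguments.
Unset Strict Implicit.
Unset Printing Implicit Defensive.

Import Order.TTheory GRing.Theory Num.Theory.
Local Open Scope ring_scope.
Local Open Scope complex_scope.

(* exp(i t), written out since the libraries have no complex exponential. *)
Definition expi (R : realType) (t : R) : R[i] := cos t +i* sin t.

(* The codomain is R[i]^o because R[i] itself also carries an R-module
   structure. Beware: as finite functions into a ring these also have a
   pointwise product; the product of the algebra is l1conv below. All these
   definitions are meant for 1 < n, since 'Z_0 and 'Z_1 are both Z/2Z. *)
Notation l1 R n := {ffun 'Z_n -> R[i]^o}.

Definition l1conv (R : realType) (n : nat) (a b : l1 R n) : l1 R n :=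
  [ffun g => \sum_(h : 'Z_n) a h * b (g - h)].

Definition l1norm (R : realType) (n : nat) (a : l1 R n) : R :=
  \sum_(g : 'Z_n) ComplexField.Normc.normc (a g).

Definition l1total (R : realType) (n : nat) (a : l1 R n) : R[i]^o :=
  \sum_(g : 'Z_n) a g.

Lemma l1total_is_linear (R : realType) (n : nat) : linear (@l1total R n).
Proof.
move=> c a b; rewrite /l1total scaler_sumr -big_split /=.
by apply: eq_bigr => g _; rewrite !ffunE.
Qed.

HB.instance Definition _ (R : realType) (n : nat) :=
  GRing.isLinear.Build R[i] (l1 R n) R[i]^o _ (@l1total R n)
    (@l1total_is_linear R n).

Definition l10 (R : realType) (n : nat) : {vspace l1 R n} :=
  lker (linfun (@l1total R n)).

Lemma mem_l10 (R : realType) (n : nat) (a : l1 R n) :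
  (a \in l10 R n) = (\sum_(g : 'Z_n) a g == 0).
Proof. by rewrite memv_ker lfunE. Qed.

Definition l1idempotent (R : realType) (n : nat) (a : l1 R n) : Prop :=
  l1conv a a = a.

Definition l1delta (R : realType) (n : nat) (g : 'Z_n) : l1 R n :=
  [ffun h => (h == g)%:R].

Definition l1Delta (R : realType) (n : nat) (g : 'Z_n) : l1 R n :=
  l1delta R g - l1delta R 0.

Definition l10_one (R : realType) (n : nat) : l1 R n :=
  - (n%:R^-1 *: \sum_(g : 'Z_n) l1Delta R g).

(* Indices 1 <= j, k <= n - 1 are represented by j, k : 'I_n.-1, the index of
   value k standing for k.+1. *)
Definition coordv (R : realType) (n : nat) (a : l1 R n) : 'cV[R[i]]_n.-1 :=
  \col_(k < n.-1) a (k.+1%:R : 'Z_n).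

Definition translation_mx (R : realType) (n : nat) : 'M[R[i]]_n.-1 :=
  \matrix_(j < n.-1, k < n.-1)
    (expi (2 * pi * (j.+1 * k.+1)%N%:R / n%:R) - 1).

Lemma expiD (R : realType) (s t : R) : expi (s + t) = expi s * expi t.
Proof.
apply/eqP; rewrite eq_complex /= cosD sinD eqxx /=.
by rewrite addrC [cos s * _ + _]addrC [sin s * _]mulrC addrC [cos t * _]mulrC.
Qed.

Lemma expiX (R : realType) (t : R) (m : nat) : expi t ^+ m = expi (m%:R * t).
Proof.
elim: m => [|m IH]; first by rewrite mul0r /expi cos0 sin0.
by rewrite exprS IH -expiD -natr1 mulrDl mul1r addrC.
Qed.

Lemma expi_neq1 (R : realType) (t : R) : 0 < t < 2 * pi -> expi t != 1.
Proof.
move=> /andP[t0 t2]; apply/eqP => -[c1 _].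
have ht : t = t / 2 + t / 2 by rewrite -splitr.
have s0 : 0 < sin (t / 2).
  by apply: sin_gt0_pi; rewrite divr_gt0//= ltr_pdivrMr// mulrC.
move: c1; rewrite ht cosD -!expr2 cos2sin2 => c1.
have : sin (t / 2) ^+ 2 = 0 by lra.
by move/eqP; rewrite expf_eq0 /= gt_eqF.
Qed.

Lemma translation_mx_inj (R : realType) (n : nat) (v : 'cV[R[i]]_n.-1) :
  (1 < n)%N -> translation_mx R n *m v = 0 -> v = 0.
Proof.
case: n v => [|n] //= v hn Xv.
pose x : 'rV[R[i]]_n.+1 := \row_k expi (2 * pi * k%:R / n.+1%:R).
have Vunit : Vandermonde n.+1 x \in unitmx.
  rewrite unitmxE unitfE det_Vandermonde; apply/prodf_neq0 => p _.
  apply/prodf_neq0 => q pq; rewrite !mxE subr_eq0.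
  have -> : 2 * pi * q%:R / n.+1%:R = 2 * pi * p%:R / n.+1%:R +
      2 * pi * (q - p)%:R / n.+1%:R :> R.
    by rewrite natrB ?(ltnW pq)//; ring.
  rewrite expiD; have p0 : expi (2 * pi * p%:R / n.+1%:R) != 0 :> R[i].
    apply/eqP => -[c0 s0]; have := cos2Dsin2 (2 * pi * p%:R / n.+1%:R : R).
    by rewrite c0 s0 !expr0n /= addr0 => /eqP; rewrite eq_sym oner_eq0.
  rewrite -subr_eq0 -{2}[expi (_ * p%:R / _)]mulr1 -mulrBr mulf_neq0// subr_eq0.
  apply: expi_neq1; have pi0 := @pi_gt0 R.
  rewrite divr_gt0 ?mulr_gt0 ?ltr0n ?subn_gt0//= ltr_pdivrMr ?ltr0n//.
  rewrite ltr_pM2l ?mulr_gt0// ltr_nat.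
  by rewrite (leq_ltn_trans (leq_subr _ _)).
pose u : 'cV[R[i]]_n.+1 :=
  \col_k (if unlift ord0 k is Some k' then v k' 0 else - \sum_i v i 0).
have uS k : u (lift ord0 k) 0 = v k 0 by rewrite !mxE liftK.
have u0 : u ord0 0 = - \sum_i v i 0 by rewrite !mxE unlift_none.
have Vu : Vandermonde n.+1 x *m u = 0.
  apply/matrixP => j z; rewrite ord1 mxE [RHS]mxE big_ord_recl u0 !mxE.
  rewrite mulr0 mul0r {1}/expi cos0 sin0 (_ : 1 +i* 0 = 1)// expr1n mul1r.
  rewrite addrC -sumrB.
  case: (unliftP ord0 j) => [j' ->|->]; last first.
    by apply: big1 => i _; rewrite uS !mxE expr0 mul1r subrr.
  transitivity ((translation_mx R n.+1 *m v) j' 0); last by rewrite Xv mxE.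
  rewrite [RHS]mxE; apply: eq_bigr => k _; rewrite uS !mxE.
  rewrite mulrBl mul1r expiX; congr (expi _ * _ - _).
  by rewrite !lift0 natrM; ring.
have u00 : u = 0 by rewrite -(mulKmx Vunit u) Vu mulmx0.
by apply/matrixP => k z; rewrite ord1 -uS u00 !mxE.
Qed.

Lemma coordv_surj (R : realType) (n : nat) (v : 'cV[R[i]]_n.-1) :
  (1 < n)%N -> exists2 a : l1 R n, a \in l10 R n & coordv a = v.
Proof.
case: n v => [|[|n]] //= v _.
pose a : l1 R n.+2 :=
  [ffun g => if unlift ord0 g is Some k then v k 0 else - \sum_i v i 0].
have aS (k : 'I_n.+1) : a (lift ord0 k) = v k 0 by rewrite ffunE liftK.
exists a.
  rewrite mem_l10 big_ord_recl ffunE unlift_none.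
  by rewrite addrC subr_eq0; apply/eqP; apply: eq_bigr => k _; exact: aS.
apply/matrixP => k z; rewrite ord1 mxE -aS; congr (a _).
by apply: val_inj; rewrite Zp_nat /= modn_small // ltnS.
Qed.

Lemma coordv_inj (R : realType) (n : nat) (a b : l1 R n) :
  (1 < n)%N -> a \in l10 R n -> b \in l10 R n -> coordv a = coordv b -> a = b.
Proof.
case: n a b => [|[|n]] //= a b _; rewrite !mem_l10.
rewrite !(big_ord_recl n.+1) => /eqP a0 /eqP b0 /matrixP ab.
have S (k : 'I_n.+1) : a (lift ord0 k) = b (lift ord0 k).
  have := ab k 0; rewrite !mxE.
  suff -> : (k.+1%:R : 'Z_n.+2) = lift ord0 k by [].
  by apply: val_inj; rewrite Zp_nat /= modn_small // ltnS.
apply/ffunP => g; case: (unliftP ord0 g) => [k ->|->] //.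
move/eqP: a0; rewrite addr_eq0 => /eqP ->.
move/eqP: b0; rewrite addr_eq0 => /eqP ->.
by congr (- _); apply: eq_bigr.
Qed.

Lemma translation_exists_unique (R : realType) (n : nat)
    (v : 'cV[R[i]]_n.-1) : (1 < n)%N ->
  exists! a : l1 R n, a \in l10 R n /\ translation_mx R n *m coordv a = v.
Proof.
move=> hn; have Xu : translation_mx R n \in unitmx.
  rewrite -unitmx_tr -row_free_unit -kermx_eq0; apply/eqP/row_matrixP => i.
  rewrite row0; apply: trmx_inj; rewrite trmx0; apply: translation_mx_inj => //.
  apply: trmx_inj; rewrite trmx_mul trmxK trmx0; apply/sub_kermxP.
  exact: row_sub.
have [a a0 ca] := coordv_surj (invmx (translation_mx R n) *m v) hn.
exists a; split=> [|b [b0 Xb]]; first by rewrite ca mulKVmx.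
by apply: coordv_inj => //; rewrite ca -Xb mulKmx.
Qed.

(* Main.v *)
Require Import Defs.
From HB Require Import structures.
From mathcomp Require Import all_boot all_order all_algebra.
From mathcomp Require Import all_classical all_reals all_analysis.
From mathcomp Require Import complex.
From mathcomp Require Import ring.

Set Implicit Arguments.
Unset Strict Implicit.
Unset Printing Implicit Defensive.

Import Order.TTheory GRing.Theory Num.Theory.
Local Open Scope classical_set_scope.
Local Open Scope ring_scope.

(** For an n-th root of unity w, the map sending a to the sum of the w^g a(g)
is a character of the convolution algebra. On elements of total 0, the entries
of X[a] are the values at a of the characters attached to the nontrivial roots
of unity. Since X is injective, a |-> X[a] is an isomorphism from l10 onto the
(n-1)-st power of C with pointwise product, and each a_k is a coordinate
idempotent of that product. *)

Definition fourier (R : realType) (n : nat) (w : R[i]) (a : l1 R n) : R[i]^o :=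
  \sum_(g : 'Z_n) w ^+ g * a g.

Lemma fourier_is_linear (R : realType) (n : nat) (w : R[i]) :
  linear (@fourier R n w).
Proof.
move=> c a b; rewrite /fourier scaler_sumr -big_split /=.
by apply: eq_bigr => g _; rewrite !ffunE mulrDr; congr (_ + _); exact: mulrCA.
Qed.

HB.instance Definition _ (R : realType) (n : nat) (w : R[i]) :=
  GRing.isLinear.Build R[i] (l1 R n) R[i]^o _ (@fourier R n w)
    (@fourier_is_linear R n w).

(** The left exponent is the sum reduced modulo [n]; [w ^+ n = 1] absorbs the reduction. *)
Lemma exprZp (R : realType) (n : nat) (w : R[i]) (g h : 'Z_n) :
  (1 < n)%N -> w ^+ n = 1 -> w ^+ (g + h)%R = w ^+ g * w ^+ h.
Proof.
case: n g h => [|[|n]] //= g h _ wn.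
by rewrite expr_mod// exprD.
Qed.

Lemma fourier_conv (R : realType) (n : nat) (w : R[i]) (a b : l1 R n) :
  (1 < n)%N -> w ^+ n = 1 ->
  fourier w (l1conv a b) = fourier w a * fourier w b.
Proof.
move=> hn wn; rewrite /fourier mulr_suml.
under eq_bigr do rewrite ffunE mulr_sumr.
rewrite exchange_big /=; apply: eq_bigr => h _.
(* Substituting [g + h] for [g] turns [b (g - h)] into [b g] and lets [w ^+ (g + h)] split. *)
rewrite (reindex_inj (addIr h)) mulr_sumr; apply: eq_bigr => g _.
by rewrite addrK exprZp// [w ^+ g * _]mulrC -!mulrA; congr (_ * _); rewrite mulrCA.
Qed.

Lemma fourier_1 (R : realType) (n : nat) (a : l1 R n) :
  fourier 1 a = \sum_(g : 'Z_n) a g.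
Proof. by apply: eq_bigr => g _; rewrite expr1n mul1r. Qed.

Lemma l10_fourier (R : realType) (n : nat) (a : l1 R n) :
  (a \in l10 R n) = (fourier 1 a == 0).
Proof. by rewrite mem_l10 fourier_1. Qed.

(** The total is the character at [w = 1], so its kernel absorbs products. *)
Lemma l1conv_l10 (R : realType) (n : nat) (a b : l1 R n) :
  (1 < n)%N -> a \in l10 R n -> l1conv a b \in l10 R n.
Proof.
move=> hn; rewrite !l10_fourier fourier_conv ?expr1n// => /eqP ->.
by rewrite mul0r.
Qed.

(** Multiplication by [w] only shifts the index by 1, so the sum is fixed by a factor other than
    1. *)
Lemma sum_expr_root (R : realType) (n : nat) (w : R[i]) :
  (1 < n)%N -> w ^+ n = 1 -> w != 1 -> \sum_(g : 'Z_n) w ^+ g = 0.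
Proof.
move=> hn wn w1; have : w * \sum_(g : 'Z_n) w ^+ g = \sum_(g : 'Z_n) w ^+ g.
  rewrite [RHS](reindex_inj (addrI 1)) mulr_sumr.
  by apply: eq_bigr => g _; rewrite exprZp//; case: n hn {wn g} => [|[|n]].
move/eqP; rewrite -subr_eq0 -{2}[\sum_g _]mul1r -mulrBl mulf_eq0 subr_eq0.
by rewrite (negPf w1) => /eqP.
Qed.

Lemma fourier_delta (R : realType) (n : nat) (w : R[i]) (g : 'Z_n) :
  fourier w (l1delta R g) = w ^+ g.
Proof.
rewrite /fourier (bigD1 g)//= ffunE eqxx mulr1 big1 ?addr0// => h hg.
by rewrite ffunE (negPf hg) mulr0.
Qed.

Lemma card_Zn (n : nat) : (1 < n)%N -> #|'Z_n| = n.
Proof. by case: n => [|[|n]] // _; rewrite card_ord. Qed.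

(** Each [l1Delta R g] contributes [w ^+ g - 1]. The cardinal is left as it stands, since it equals
    [n] only when [1 < n]. *)
Lemma fourier_one (R : realType) (n : nat) (w : R[i]) :
  fourier w (l10_one R n) =
  - (n%:R^-1 * (\sum_(g : 'Z_n) w ^+ g - #|'Z_n|%:R)).
Proof.
rewrite /l10_one linearN linearZ /= [fourier w _]linear_sum /=.
under eq_bigr do rewrite /l1Delta linearB /= !fourier_delta expr0.
by rewrite sumrB sumr_const.
Qed.

Lemma fourier_one_root (R : realType) (n : nat) (w : R[i]) :
  (1 < n)%N -> w ^+ n = 1 -> w != 1 -> fourier w (l10_one R n) = 1.
Proof.
move=> hn wn w1; rewrite fourier_one sum_expr_root// card_Zn// sub0r mulrN opprK.
by rewrite mulVf// pnatr_eq0 -lt0n ltnW.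
Qed.

Lemma l10_one_in (R : realType) (n : nat) : l10_one R n \in l10 R n.
Proof.
rewrite l10_fourier fourier_one; under eq_bigr do rewrite expr1n.
by rewrite sumr_const subrr mulr0 oppr0.
Qed.

Lemma normc_expi (R : realType) (t : R) : ComplexField.Normc.normc (expi t) = 1.
Proof. by rewrite /= cos2Dsin2 sqrtr1. Qed.

(** This is the triangle inequality with weights of modulus 1; it yields the lower bound on the
    norms of the idempotents. *)
Lemma normc_fourier (R : realType) (n : nat) (t : R) (a : l1 R n) :
  ComplexField.Normc.normc (fourier (expi t) a) <= l1norm a.
Proof.
(* Inside [R[i]], [normc] becomes the norm [|z|], to which the general triangle inequality
   applies. *)
rewrite -lecR.
have normE (z : R[i]) : (ComplexField.Normc.normc z)%:C%C = `|z| by [].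
rewrite normE /l1norm rmorph_sum /=.
apply: le_trans (ler_norm_sum _ _ _) _; apply: ler_sum => g _.
by rewrite normE normrM normrX -(normE (expi t)) normc_expi expr1n mul1r.
Qed.

Definition root_angle (R : realType) (n : nat) (j : 'I_n.-1) : R :=
  2 * pi * j.+1%:R / n%:R.

Definition hat (R : realType) (n : nat) (j : 'I_n.-1) : l1 R n -> R[i]^o :=
  fourier (expi (root_angle R j)).

HB.instance Definition _ (R : realType) (n : nat) (j : 'I_n.-1) :=
  GRing.Linear.on (@hat R n j).

Lemma expi_root_angle_expn (R : realType) (n : nat) (j : 'I_n.-1) :
  (1 < n)%N -> expi (root_angle R j) ^+ n = 1.
Proof.
move=> hn; rewrite expiX /root_angle.
have -> : n%:R * (2 * pi * j.+1%:R / n%:R) = j.+1%:R * (pi *+ 2) :> R.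
  rewrite mulrC divfK ?pnatr_eq0 -?lt0n ?(ltnW hn)//.
  by rewrite mulrC mulr_natl.
by rewrite -expiX /expi cos2pi sin2pi; exact: expr1n.
Qed.

Lemma expi_root_angle_neq1 (R : realType) (n : nat) (j : 'I_n.-1) :
  (1 < n)%N -> expi (root_angle R j) != 1.
Proof.
move=> hn; apply: expi_neq1; have pi0 := @pi_gt0 R.
have n0 : (0 : R) < n%:R by rewrite ltr0n ltnW.
rewrite divr_gt0 ?mulr_gt0//= ltr_pdivrMr// ltr_pM2l ?mulr_gt0// ltr_nat.
by rewrite -ltn_predRL.
Qed.

Lemma hat_conv (R : realType) (n : nat) (j : 'I_n.-1) (a b : l1 R n) :
  (1 < n)%N -> hat j (l1conv a b) = hat j a * hat j b.
Proof. by move=> hn; apply: fourier_conv; rewrite ?expi_root_angle_expn. Qed.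

Lemma hat_one (R : realType) (n : nat) (j : 'I_n.-1) :
  (1 < n)%N -> hat j (l10_one R n) = 1.
Proof.
move=> hn; apply: fourier_one_root => //.
  exact: expi_root_angle_expn.
exact: expi_root_angle_neq1.
Qed.

(** Subtracting the total, which is 0, from [hat j a] replaces each weight [w ^+ g] by [w ^+ g - 1].
    The term at [g = 0] then vanishes, and the remaining weights form row [j] of the matrix. *)
Lemma translation_mxE (R : realType) (n : nat) (j : 'I_n.-1) (a : l1 R n) :
  (1 < n)%N -> a \in l10 R n ->
  (translation_mx R n *m coordv a) j 0 = hat j a.
Proof.
case: n j a => [|[|n]] //= j a _; rewrite mem_l10 => /eqP a0.
rewrite -[RHS]subr0 -a0 /hat /fourier -sumrB big_ord_recl expr0 mul1r subrr add0r.
rewrite mxE; apply: eq_bigr => k _; rewrite !mxE.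
have -> : (k.+1%:R : 'Z_n.+2) = lift ord0 k.
  by apply: val_inj; rewrite Zp_nat /= modn_small // ltnS.
rewrite -[X in _ = _ - X]mul1r -mulrBl expiX lift0 /root_angle.
congr (_ * _); congr (_ - _); congr expi.
by rewrite natrM; ring.
Qed.

(** This is the uniqueness of solutions of [X[a] = v]. It reduces identities in [l10] to identities
    between character values. *)
Lemma hat_inj (R : realType) (n : nat) (a b : l1 R n) :
  (1 < n)%N -> a \in l10 R n -> b \in l10 R n ->
  (forall j : 'I_n.-1, hat j a = hat j b) -> a = b.
Proof.
move=> hn a0 b0 ab.
have [c [_ cu]] := translation_exists_unique (translation_mx R n *m coordv a) hn.
rewrite -(cu a)//; apply: cu; split=> //.
by apply/matrixP => j z; rewrite ord1 !translation_mxE.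
Qed.

Theorem proposition5p8 (R : realType) (n : nat) (hn : (1 < n)%N)
    (a : 'I_n.-1 -> l1 R n)
    (ha : forall k : 'I_n.-1,
        a k \in l10 R n /\
        translation_mx R n *m coordv (a k) = delta_mx k 0) :
  (forall k : 'I_n.-1, l1idempotent (a k) /\ 1 <= l1norm (a k)) /\
  (forall k j : 'I_n.-1, k <> j -> l1conv (a k) (a j) = 0) /\
  \sum_(k < n.-1) a k = l10_one R n /\
  basis_of (l10 R n) [tuple a k | k < n.-1] /\
  (forall b : l1 R n, b \in l10 R n -> b <> 0 -> l1idempotent b ->
     exists eps : {ffun 'I_n.-1 -> bool},
       eps <> [ffun=> false] /\
       b = \sum_(k < n.-1) (eps k)%:R *: a k) /\
  ([set b : l1 R n | b \in l10 R n /\ l1idempotent b] #= `I_(2 ^ n.-1))%card.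
Proof.
have a0 k : a k \in l10 R n by have [] := ha k.
have hata j k : hat j (a k) = (j == k)%:R.
  by rewrite -translation_mxE//; have [_ ->] := ha k; rewrite mxE eqxx andbT.
have comb0 (c : 'I_n.-1 -> R[i]) : \sum_k c k *: a k \in l10 R n.
  by apply: memv_suml => k _; exact: memvZ.
(* The characters [hat j] are the coordinate functionals dual to the family [a]. *)
have hatcomb (c : 'I_n.-1 -> R[i]) j : hat j (\sum_k c k *: a k) = c j.
  rewrite linear_sum /= (bigD1 j)//= big1 ?addr0 => [|k kj].
    by rewrite linearZ /= hata eqxx; exact: mulr1.
  by rewrite linearZ /= hata eq_sym (negPf kj); exact: mulr0.
have expand b : b \in l10 R n -> b = \sum_k hat k b *: a k.
  by move=> b0; apply: hat_inj => // j; rewrite hatcomb.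
(* The next three facts make [idem] a bijection from 0-1 vectors onto the idempotents of [l10],
   which serves both (5) and (6). *)
pose idem (eps : {ffun 'I_n.-1 -> bool}) := \sum_(k < n.-1) (eps k)%:R *: a k.
have idemP eps : l1idempotent (idem eps).
  apply: hat_inj => //; first exact/l1conv_l10/comb0.
    exact: comb0.
  by move=> j; rewrite hat_conv// hatcomb; case: (eps j); rewrite ?mulr1 ?mulr0.
have idem_inj : injective idem.
  move=> e1 e2 e12; apply/ffunP => j; have := hatcomb (fun k => (e1 k)%:R) j.
  rewrite -/(idem e1) e12 hatcomb => /eqP.
  by case: (e1 j) (e2 j) => [] []; rewrite // ?oner_eq0 // eq_sym oner_eq0.
have idem_surj b : b \in l10 R n -> l1idempotent b ->
    b = idem [ffun k => hat k b == 1].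
  move=> b0 bb; rewrite {1}(expand b b0); apply: eq_bigr => k _; rewrite ffunE.
  (* Each [hat k b] equals its own square in a field, hence is 0 or 1. *)
  congr (_ *: _); have /eqP := hat_conv k b b hn.
  rewrite bb -subr_eq0 -{1}[hat k b]mulr1 -mulrBr mulf_eq0 subr_eq0.
  by case/orP => [/eqP ->|/eqP <-]; rewrite ?eqxx// eq_sym oner_eq0.
split; [move=> k; split|split; [|split; [|split; [|split]]]].
- apply: hat_inj => //; first exact: l1conv_l10.
  by move=> j; rewrite hat_conv// hata; case: (j == k); rewrite ?mulr1 ?mulr0.
(* The norm of [a k] dominates the modulus of [hat k (a k)], which is 1. *)
- have := normc_fourier (root_angle R k) (a k).
  rewrite -[fourier _ _]/(hat k (a k)) hata eqxx.
  by rewrite ComplexField.Normc.normc1.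
- move=> k j /eqP kj; apply: hat_inj => //; first exact: l1conv_l10.
    exact: mem0v.
  move=> i; rewrite hat_conv// !hata linear0; case: eqP => [->|_]; last exact: mul0r.
  by rewrite (negPf kj) mulr0.
(* Every [hat j] takes the value 1 on both sides. *)
- apply: hat_inj => //; [exact: memv_suml|exact: l10_one_in|move=> j].
  rewrite hat_one// -(hatcomb (fun=> 1) j); congr hat.
  by apply: eq_bigr => k _; rewrite scale1r.
(* Spanning comes from [expand]; for freeness, [hatcomb] reads each coefficient off a vanishing
   combination. *)
- rewrite /basis_of; apply/andP; split.
    rewrite eqEsubv; apply/andP; split; first by apply/span_subvP => _ /mapP[k _ ->].
    apply/subvP => b /expand ->; apply: memv_suml => k _; apply: memvZ.
    by apply: memv_span; apply: map_f; rewrite mem_enum.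
  apply/freeP => c c0 j; rewrite -(hatcomb c j) -[RHS](linear0 (hat j)).
  by congr hat; rewrite -[RHS]c0; apply: eq_bigr => k _; rewrite nth_mktuple.
- move=> b b0 bN0 bb; exists [ffun k => hat k b == 1]; split; last exact: idem_surj.
  move=> e0; apply: bN0; rewrite (idem_surj b)// e0 /idem big1// => k _.
  by rewrite ffunE scale0r.
(* The 0-1 vectors are numbered by their position in the enumeration; the default of [nth] is
   returned only from index [2 ^ n.-1] on, outside the range counted. *)
- pose e i := nth [ffun=> false] (enum {ffun 'I_n.-1 -> bool}) i.
  have se : size (enum {ffun 'I_n.-1 -> bool}) = (2 ^ n.-1)%N.
    by rewrite -cardE card_ffun card_bool card_ord.
  have -> : [set b : l1 R n | b \in l10 R n /\ l1idempotent b] =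
      (idem \o e) @` `I_(2 ^ n.-1).
    apply/seteqP; split=> [b [b0 bb]|_ [i _ <-]]; last first.
      by split; [exact: comb0|exact: idemP].
    exists (index [ffun k => hat k b == 1] (enum {ffun 'I_n.-1 -> bool})).
      by rewrite /= -se index_mem mem_enum.
    by rewrite /= /e nth_index ?mem_enum// -idem_surj.
  apply: inj_card_eq => i j /set_mem /= i_lt /set_mem /= j_lt /idem_inj /eqP.
  by rewrite nth_uniq ?enum_uniq ?se// => /eqP.
Qed.
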